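(* Let $H$ be a Hadamard manifold, $E\subseteq H$ a nonempty open geodesic convex set, $\phi_s:E\to\mathbb{I}$, $\phi_s(p)=[\phi_s^L(p),\phi_s^U(p)]$, $s\in\{1,\dots,l\}$, and $\psi_u:E\to\mathbb{R}$, $u\in\{1,\dots,t\}$, $F=\{p\in E:\psi_u(p)\le0,\ u=1,\dots,t\}$, and consider the problem (MIVOP2) of minimizing $\phi=(\phi_1,\dots,\phi_l)$ over $F$. Let $\bar p\in F$ and $J(\bar p)=\{u\in\{1,\dots,t\}:\psi_u(\bar p)=0\}$. Assume that all $\psi_u$ are directionally differentiable at $\bar p$, that $\psi_u$, $u\in J(\bar p)$, are strictly pseudo-convex at $\bar p$, and that there exists $c\in\{1,\dots,l\}$ such that $\phi_c$ is weakly directionally differentiable at $\bar p$. (a) If $\phi_c$ is LU-pseudo-convex at $\bar p$ and for every $p\in F$ there exist real numbers $\mu_u^L\ge0,\mu_u^U\ge0$, $u\in\{1,\dots,t\}$, such that (i) $(\phi_c^L)'(\bar p;\exp_{\bar p}^{-1}p)+\sum_{u=1}^{t}\mu_u^L\psi_u'(\bar p;\exp_{\bar p}^{-1}p)\ge0$; (ii) $(\phi_c^U)'(\bar p;\exp_{\bar p}^{-1}p)+\sum_{u=1}^{t}\mu_u^U\psi_u'(\bar p;\exp_{\bar p}^{-1}p)\ge0$; (iii) $\mu_u^L\psi_u(\bar p)=0=\mu_u^U\psi_u(\bar p)$, $u\in\{1,\dots,t\}$, then $\bar p$ is a weakly type-I Pareto optimal solution of (MIVOP2). (b) If $\phi_c$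 is CW-pseudo-convex at $\bar p$ and for every $p\in F$ there exist real numbers $\mu_u^C\ge0,\mu_u^W\ge0$, $u\in\{1,\dots,t\}$, such that (iv) $(\phi_c^C)'(\bar p;\exp_{\bar p}^{-1}p)+\sum_{u=1}^{t}\mu_u^C\psi_u'(\bar p;\exp_{\bar p}^{-1}p)\ge0$; (v) $(\phi_c^W)'(\bar p;\exp_{\bar p}^{-1}p)+\sum_{u=1}^{t}\mu_u^W\psi_u'(\bar p;\exp_{\bar p}^{-1}p)\ge0$; (vi) $\mu_u^C\psi_u(\bar p)=0=\mu_u^W\psi_u(\bar p)$, $u\in\{1,\dots,t\}$, then $\bar p$ is a weakly type-II Pareto optimal solution of (MIVOP2).
   Context: A Hadamard manifold $H$ is a complete simply connected Riemannian manifold of non-positive sectional curvature; for $p\in H$ the map $\exp_p:T_p(H)\to H$ is a diffeomorphism with inverse $\exp_p^{-1}$, and the geodesic joining $p$ to $q$ is $\gamma_{p,q}(\alpha)=\exp_p(\alpha\exp_p^{-1}q)$, $\alpha\in[0,1]$. A set $E\subseteq H$ is geodesic convex if $\gamma_{p,q}(\alpha)\in E$ for all $p,q\in E$, $\alpha\in[0,1]$. The feasible set $F$ is assumed geodesic convex. For $f:E\to\mathbb{R}$, the directional derivative is $f'(p;w)=\lim_{\alpha\to0^+}\frac{f(\exp_p(\alpha w))-f(p)}{\alpha}$, $w\in T_p(H)$; $f$ is directionally differentiable at $p$ if it exists (finite) for all $w\in T_p(H)$. A directionally differentiable $f$ is pseudo-convex at $\bar p\in E$ if for every $p\in E$, $f(p)<f(\bar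 p)$ implies $f'(\bar p;\exp_{\bar p}^{-1}p)<0$; it is strictly pseudo-convex at $\bar p$ if for every $p\in E$ with $p\ne\bar p$, $f(p)\le f(\bar p)$ implies $f'(\bar p;\exp_{\bar p}^{-1}p)<0$. Here only directional differentiability at $\bar p$ is required. $\mathbb{I}$ is the set of closed bounded intervals of $\mathbb{R}$. For $T=[t^L,t^U]$ put $t^C=\frac12(t^L+t^U)$, $t^W=\frac12(t^U-t^L)$. $T\leqq_{LU}S$ iff $t^L\le s^L$ and $t^U\le s^U$; $T\leqq_{CW}S$ iff $t^C\le s^C$ and $t^W\le s^W$; for either order, $T<S$ means $T\leqq S$ and $T\ne S$. For $f=[f^L,f^U]:E\to\mathbb{I}$ put $f^C=\frac12(f^L+f^U)$, $f^W=\frac12(f^U-f^L)$. $f$ is weakly directionally differentiable at $p$ if $f^L$ and $f^U$ are directionally differentiable at $p$. Such an $f$ is LU-pseudo-convex at $\bar p$ if $f^L$ and $f^U$ are pseudo-convex at $\bar p$, and CW-pseudo-convex at $\bar p$ if $f^C$ and $f^W$ are pseudo-convex at $\bar p$. $\bar p\in F$ is a weakly type-I (resp. weakly type-II) Pareto optimal solution of (MIVOP2) if there is no $\hat p\in F$ with $\phi_s(\hat p)<_{LU}\phi_s(\bar p)$ (resp. $\phi_s(\hat p)<_{CW}\phi_s(\bar p)$) for all $s\in\{1,\dots,l\}$. *)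

(* Defs.v *)
From HB Require Import structures.
From mathcomp Require Import all_boot all_order all_algebra.
From mathcomp Require Import all_classical all_reals all_analysis.

Set Implicit Arguments.
Unset Strict Implicit.
Unset Printing Implicit Defensive.

Import Order.TTheory GRing.Theory Num.Theory.
Import numFieldNormedType.Exports.

Local Open Scope classical_set_scope.
Local Open Scope ring_scope.

(* Vectors of R^n are rows. Hence a linear map acts on the right, and the row i
   of the library's Jacobian matrix 'J f x is the i-th partial derivative. *)
Section Calculus.
Context {R : realType} {n : nat} {W : normedModType R}.

Definition partial (i : 'I_n) (f : 'rV[R]_n -> W) : 'rV[R]_n -> W :=
  'D_(delta_mx 0 i) f.

(* C^oo on the open set D: all the iterated partial derivatives exist and are
   continuous at each point of D. *)
Definition smooth_on (D : set 'rV[R]_n) (f : 'rV[R]_n -> W) : Prop :=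
  forall (s : seq 'I_n) (x : 'rV[R]_n), D x ->
    {for x, continuous (foldr partial f s)} /\
    forall i : 'I_n, derivable (foldr partial f s) x (delta_mx 0 i).

End Calculus.

Section SimplyConnected.
Context (R : realType) (T : topologicalType).

Definition path_connected : Prop :=
  forall x y : T, exists c : R -> T,
    [/\ {within `[0, 1], continuous c}, c 0 = x & c 1 = y].

Definition null_homotopic (c : R -> T) : Prop :=
  exists h : R * R -> T,
    [/\ {within `[0, 1] `*` `[0, 1], continuous h},
        forall t : R, 0 <= t <= 1 -> h (0, t) = c t,
        forall t : R, 0 <= t <= 1 -> h (1, t) = c 0
      & forall s : R, 0 <= s <= 1 -> h (s, 0) = c 0 /\ h (s, 1) = c 0].

Definition simply_connected : Prop :=
  path_connected /\
  forall c : R -> T,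
    {within `[0, 1], continuous c} -> c 0 = c 1 -> null_homotopic c.

End SimplyConnected.

(* A smooth n-manifold. The atlas is indexed by the points, chart p being a
   chart around p. This loses no generality: one chart around each point can be
   selected in any atlas, and these charts determine the smooth structure. *)
Record manifold (R : realType) (n : nat) := Manifold {
  manifold_sort :> topologicalType ;
  manifold_hausdorff : hausdorff_space manifold_sort ;
  manifold_second_countable : @second_countable manifold_sort ;
  chart_dom : manifold_sort -> set manifold_sort ;
  chart : manifold_sort -> manifold_sort -> 'rV[R]_n ;
  chart_inv : manifold_sort -> 'rV[R]_n -> manifold_sort ;
  chart_dom_open : forall p, open (chart_dom p) ;
  chart_dom_center : forall p, chart_dom p p ;
  chart_image_open : forall p, open (chart p @` chart_dom p) ;
  chartK : forall p q, chart_dom p q -> chart_inv p (chart p q) = q ;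
  chart_continuous : forall p, {within chart_dom p, continuous (chart p)} ;
  chart_inv_continuous : forall p,
    {within chart p @` chart_dom p, continuous (chart_inv p)} ;
  chart_transition_smooth : forall p q,
    smooth_on (chart p @` (chart_dom p `&` chart_dom q))
              (chart q \o chart_inv p)
}.

(* The tangent space at p is 'rV[R]_n: a tangent vector at p is given by its
   components in the chart around p. A field of inner products on the tangent
   spaces is given by its Gram matrices in these frames. The matrix below
   expresses it in the coordinates x of chart p: a vector v at
   q = chart_inv p x in that coordinate frame has components v *m J in the
   reference frame at q. *)
Definition metric_in_chart (R : realType) (n : nat) (M : manifold R n)
    (gram : M -> 'M[R]_n) (p : M) (x : 'rV[R]_n) : 'M[R]_n :=
  let q := chart_inv p x in
  let J := 'J (chart q \o chart_inv p) x in
  J *m gram q *m J^T.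

Section LocalGeometry.
Context {R : realType} {n : nat}.
Implicit Types (G : 'rV[R]_n -> 'M[R]_n) (x v w : 'rV[R]_n).

Definition inner (g : 'M[R]_n) v w : R := (v *m g *m w^T) 0 0.

(* Gamma^k_ij *)
Definition christoffel G (i j k : 'I_n) x : R :=
  2^-1 * \sum_(l < n) invmx (G x) k l *
    (partial i (fun y => G y j l) x + partial j (fun y => G y i l) x
     - partial l (fun y => G y i j) x).

(* The component on d_l of Riem(d_i, d_j) d_k, with the sign convention
   Riem(X, Y) Z = nabla_X nabla_Y Z - nabla_Y nabla_X Z - nabla_[X, Y] Z. *)
Definition riemann G (i j k l : 'I_n) x : R :=
  partial i (christoffel G j k l) x - partial j (christoffel G i k l) x
  + \sum_(m < n) (christoffel G i m l x * christoffel G j k m x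
                  - christoffel G j m l x * christoffel G i k m x).

(* Riem(v, w) w *)
Definition riemann_vec G x v w : 'rV[R]_n :=
  \row_l \sum_(i < n) \sum_(j < n) \sum_(k < n)
    riemann G i j k l x * v 0 i * w 0 j * w 0 k.

Definition sectional_curvature G x v w : R :=
  inner (G x) (riemann_vec G x v w) v /
  (inner (G x) v v * inner (G x) w w - inner (G x) v w ^+ 2).

Definition geodesic_eq G (c : R -> 'rV[R]_n) (t : R) : Prop :=
  [/\ \forall s \near t, derivable c s 1,
      derivable (derive1 c) t 1
    & forall k : 'I_n,
        derive1n 2 c t 0 k + \sum_(i < n) \sum_(j < n)
          christoffel G i j k (c t) * derive1 c t 0 i * derive1 c t 0 j = 0].

End LocalGeometry.

Record riemannian_manifold (R : realType) (n : nat) := RiemannianManifold {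
  riemannian_sort :> manifold R n ;
  metric : riemannian_sort -> 'M[R]_n ;
  metric_sym : forall p, (metric p)^T = metric p ;
  metric_pos : forall p v, v != 0 -> 0 < inner (metric p) v v ;
  metric_smooth : forall p i j,
    smooth_on (chart p @` chart_dom p)
              (fun x => metric_in_chart metric p x i j)
}.

Section Geodesics.
Context {R : realType} {n : nat} (M : riemannian_manifold R n).

Definition geodesic (c : R -> M) : Prop :=
  continuous c /\
  forall (p : M) (t : R), chart_dom p (c t) ->
    geodesic_eq (metric_in_chart (@metric R n M) p) (chart p \o c) t.

Definition geodesic_from (p : M) (v : 'rV[R]_n) (c : R -> M) : Prop :=
  [/\ geodesic c, c 0 = p & derive1 (chart p \o c) 0 = v].

Definition complete_manifold : Prop :=
  forall (p : M) (v : 'rV[R]_n), exists c : R -> M, geodesic_from p v c.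

Definition nonpositive_curvature : Prop :=
  forall (p : M) (v w : 'rV[R]_n), row_free (col_mx v w) ->
    sectional_curvature (metric_in_chart (@metric R n M) p) (chart p p) v w
      <= 0.

End Geodesics.

Record hadamard_manifold (R : realType) (n : nat) := HadamardManifold {
  hadamard_sort :> riemannian_manifold R n ;
  hadamard_complete : complete_manifold hadamard_sort ;
  hadamard_simply_connected : simply_connected R hadamard_sort ;
  hadamard_nonpositive_curvature : nonpositive_curvature hadamard_sort
}.

Section Exponential.
Context {R : realType} {n : nat} {H : hadamard_manifold R n}.

(* xget selects an element of a set (its first argument is the default value
   for the empty set). Here both sets are singletons: the first one by
   completeness and uniqueness of geodesics, the second one because the
   exponential map of a Hadamard manifold is bijective (Cartan-Hadamard). *)
Definition exp_map (p : H) (v : 'rV[R]_n) : H :=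
  xget p [set q | exists2 c : R -> H, geodesic_from p v c & c 1 = q].

Definition exp_inv (p q : H) : 'rV[R]_n := xget 0 [set v | exp_map p v = q].

Definition geodesic_segment (p q : H) (a : R) : H :=
  exp_map p (a *: exp_inv p q).

Definition geodesic_convex (E : set H) : Prop :=
  forall (p q : H) (a : R), E p -> E q -> 0 <= a <= 1 ->
    E (geodesic_segment p q a).

(* A function on the open set E is represented by a function on H; only its
   values on E matter, also below since exp_map p (a *: w) is in E for all
   small a when p is in E. *)
Definition difference_quotient (f : H -> R) (p : H) (w : 'rV[R]_n) (a : R) :=
  (f (exp_map p (a *: w)) - f p) / a.

Definition directional_derivative (f : H -> R) (p : H) (w : 'rV[R]_n) : R :=
  lim (difference_quotient f p w a @[a --> 0^'+]).

Definition directionally_differentiable (f : H -> R) (p : H) : Prop :=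
  forall w : 'rV[R]_n, cvg (difference_quotient f p w a @[a --> 0^'+]).

Definition pseudo_convex (E : set H) (f : H -> R) (pbar : H) : Prop :=
  directionally_differentiable f pbar /\
  forall p : H, E p -> f p < f pbar ->
    directional_derivative f pbar (exp_inv pbar p) < 0.

Definition strictly_pseudo_convex (E : set H) (f : H -> R) (pbar : H) : Prop :=
  directionally_differentiable f pbar /\
  forall p : H, E p -> p <> pbar -> f p <= f pbar ->
    directional_derivative f pbar (exp_inv pbar p) < 0.

End Exponential.

Record closed_interval (R : realType) := ClosedInterval {
  lower : R ;
  upper : R ;
  lower_le_upper : lower <= upper
}.
Arguments lower {R} _.
Arguments upper {R} _.

Section Intervals.
Context {R : realType}.
Implicit Types T S : closed_interval R.

Definition itv_center T : R := 2^-1 * (lower T + upper T).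
Definition itv_halfwidth T : R := 2^-1 * (upper T - lower T).

Definition le_LU T S : Prop := lower T <= lower S /\ upper T <= upper S.
Definition lt_LU T S : Prop := le_LU T S /\ T <> S.

Definition le_CW T S : Prop :=
  itv_center T <= itv_center S /\ itv_halfwidth T <= itv_halfwidth S.
Definition lt_CW T S : Prop := le_CW T S /\ T <> S.

End Intervals.

Section IntervalFunctions.
Context {R : realType} {n : nat} {H : hadamard_manifold R n}.
Implicit Types (f : H -> closed_interval R) (E F : set H) (p pbar : H).

Definition weakly_directionally_differentiable f p : Prop :=
  directionally_differentiable (lower \o f) p /\
  directionally_differentiable (upper \o f) p.

Definition LU_pseudo_convex E f pbar : Prop :=
  pseudo_convex E (lower \o f) pbar /\ pseudo_convex E (upper \o f) pbar.

Definition CW_pseudo_convex E f pbar : Prop :=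
  pseudo_convex E (itv_center \o f) pbar /\ pseudo_convex E (itv_halfwidth \o f) pbar.

Definition feasible_set (t : nat) E (psi : 'I_t -> H -> R) : set H :=
  [set p | E p /\ forall u : 'I_t, psi u p <= 0].

Definition active_set (t : nat) (psi : 'I_t -> H -> R) pbar : {set 'I_t} :=
  [set u : 'I_t | psi u pbar == 0].

Definition weakly_type_I_Pareto_optimal (l : nat) F
    (phi : 'I_l -> H -> closed_interval R) pbar : Prop :=
  F pbar /\
  ~ exists2 phat : H, F phat & forall s : 'I_l, lt_LU (phi s phat) (phi s pbar).

Definition weakly_type_II_Pareto_optimal (l : nat) F
    (phi : 'I_l -> H -> closed_interval R) pbar : Prop :=
  F pbar /\
  ~ exists2 phat : H, F phat & forall s : 'I_l, lt_CW (phi s phat) (phi s pbar).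

End IntervalFunctions.

(* Main.v *)
Require Import Defs.
From HB Require Import structures.
From mathcomp Require Import all_boot all_order all_algebra.
From mathcomp Require Import all_classical all_reals all_analysis.
From mathcomp Require Import lra.
Import Order.TTheory GRing.Theory Num.Theory.
Import numFieldNormedType.Exports.
Local Open Scope classical_set_scope.
Local Open Scope ring_scope.

(** The two parts are one scalar fact, used twice in each part.
    Let [f] be pseudo-convex at [pbar], and let a feasible [p] have
    [f p < f pbar]. Then [f] has a negative derivative at [pbar] towards [p].
    So does every active constraint, by strict pseudo-convexity, because
    [psi u p <= 0 = psi u pbar]. Complementary slackness kills the multipliers
    of the inactive constraints, hence the Lagrangian derivative is negative
    towards [p], against the stationarity condition. Thus [pbar] minimizes
    each of the two scalar functions attached to [phi c]
    ([multipliers_minimize]).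

    If a feasible point dominated [pbar], then the two scalar inequalities of
    the order would be equalities by minimality. The endpoints, or the center
    and the half-width, determine an interval, so the two values of [phi c]
    would coincide, which the strict order excludes. Domination in the single
    component [c] is already contradictory. *)

Section Multipliers.
Context {R : realType} {n : nat} {H : hadamard_manifold R n} {t : nat}.
Variables (E : set H) (psi : 'I_t -> H -> R) (pbar : H).
Hypothesis psi_convex : forall u : 'I_t, u \in active_set psi pbar ->
  strictly_pseudo_convex E (psi u) pbar.

(** Complementary slackness leaves only active constraints in the sum, and
    these do not increase from their value [0] at [pbar] to [p], so that strict
    pseudo-convexity makes their derivatives towards [p] negative. *)
Lemma multiplier_sum_le0 (p : H) (mu : 'I_t -> R) :
    feasible_set E psi p -> p <> pbar ->
    (forall u, 0 <= mu u) -> (forall u, mu u * psi u pbar = 0) ->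
  \sum_(u < t) mu u * directional_derivative (psi u) pbar (exp_inv pbar p)
    <= 0.
Proof.
move=> [Ep psip] p_neq mu_ge0 slack; apply: sumr_le0 => u _.
have /eqP := slack u; rewrite mulf_eq0 => /orP[/eqP->|psi0].
  by rewrite mul0r.
have [|_ /(_ p Ep p_neq)] := psi_convex u; first by rewrite inE.
rewrite (eqP psi0) => /(_ (psip u)) dpsi.
exact: mulr_ge0_le0 (mu_ge0 u) (ltW dpsi).
Qed.

(** Sufficiency of the Karush-Kuhn-Tucker conditions for a scalar objective:
    if [f] were smaller at [p], both terms of the stationarity inequality would
    be nonpositive and the first one negative. It is stated for one competitor
    [p] since the multipliers may depend on it. *)
Lemma multipliers_minimize (f : H -> R) (p : H) (mu : 'I_t -> R) :
    pseudo_convex E f pbar -> feasible_set E psi p ->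
    (forall u, 0 <= mu u) ->
    0 <= directional_derivative f pbar (exp_inv pbar p)
       + \sum_(u < t) mu u *
           directional_derivative (psi u) pbar (exp_inv pbar p) ->
    (forall u, mu u * psi u pbar = 0) ->
  f pbar <= f p.
Proof.
move=> [_ f_convex] Fp mu_ge0 stationary slack.
rewrite leNgt; apply/negP => f_lt.
have p_neq : p <> pbar by move=> p_eq; rewrite p_eq ltxx in f_lt.
have := multiplier_sum_le0 p mu Fp p_neq mu_ge0 slack.
have := f_convex p (proj1 Fp) f_lt.
lra.
Qed.

End Multipliers.

Section IntervalOrders.
Context {R : realType}.
Implicit Types T S : closed_interval R.

Lemma closed_interval_eq T S : lower T = lower S -> upper T = upper S -> T = S.
Proof.
case: T S => [a b ab] [a' b' ab'] /= eq_a eq_b.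
by case: _ / eq_a ab'; case: _ / eq_b => ab'; rewrite (bool_irrelevance ab ab').
Qed.

Lemma le_LU_anti T S : le_LU T S -> le_LU S T -> T = S.
Proof. by move=> [? ?] [? ?]; apply: closed_interval_eq; lra. Qed.

Lemma le_CW_anti T S : le_CW T S -> le_CW S T -> T = S.
Proof.
rewrite /le_CW /itv_center /itv_halfwidth => -[? ?] [? ?].
by apply: closed_interval_eq; lra.
Qed.

End IntervalOrders.

Theorem theorem3p6 (R : realType) (n : nat) (H : hadamard_manifold R n)
    (E : set H) (l t : nat)
    (phi : 'I_l -> H -> closed_interval R) (psi : 'I_t -> H -> R) (pbar : H)
    (c : 'I_l)
    (E_nonempty : E !=set0) (E_open : open E) (E_convex : geodesic_convex E)
    (F_convex : geodesic_convex (feasible_set E psi))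
    (pbar_feasible : feasible_set E psi pbar)
    (psi_differentiable :
       forall u : 'I_t, directionally_differentiable (psi u) pbar)
    (psi_convex :
       forall u : 'I_t, u \in active_set psi pbar ->
         strictly_pseudo_convex E (psi u) pbar)
    (phi_differentiable : weakly_directionally_differentiable (phi c) pbar) :
  (LU_pseudo_convex E (phi c) pbar ->
   (forall p : H, feasible_set E psi p ->
      exists muL muU : 'I_t -> R,
        [/\ forall u : 'I_t, 0 <= muL u /\ 0 <= muU u,
            0 <= directional_derivative (lower \o phi c) pbar (exp_inv pbar p)
               + \sum_(u < t) muL u *
                   directional_derivative (psi u) pbar (exp_inv pbar p),
            0 <= directional_derivative (upper \o phi c) pbar (exp_inv pbar p)
               + \sum_(u < t) muU u *
                   directional_derivative (psi u) pbar (exp_inv pbar p)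
          & forall u : 'I_t,
              muL u * psi u pbar = 0 /\ muU u * psi u pbar = 0]) ->
   weakly_type_I_Pareto_optimal (feasible_set E psi) phi pbar)
  /\
  (CW_pseudo_convex E (phi c) pbar ->
   (forall p : H, feasible_set E psi p ->
      exists muC muW : 'I_t -> R,
        [/\ forall u : 'I_t, 0 <= muC u /\ 0 <= muW u,
            0 <= directional_derivative (itv_center \o phi c) pbar (exp_inv pbar p)
               + \sum_(u < t) muC u *
                   directional_derivative (psi u) pbar (exp_inv pbar p),
            0 <= directional_derivative (itv_halfwidth \o phi c) pbar
                   (exp_inv pbar p)
               + \sum_(u < t) muW u *
                   directional_derivative (psi u) pbar (exp_inv pbar p)
          & forall u : 'I_t,
              muC u * psi u pbar = 0 /\ muW u * psi u pbar = 0]) ->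
   weakly_type_II_Pareto_optimal (feasible_set E psi) phi pbar).
Proof.
split=> pc kkt; split=> // -[phat Fphat /(_ c)[le_phat neq_phat]];
  apply: neq_phat;
  have [mu1 [mu2 [mu_ge0 stat1 stat2 slack]]] := kkt _ Fphat;
  have [pc1 pc2] := pc;
  have min1 := multipliers_minimize _ _ _ psi_convex _ _ mu1 pc1 Fphat
    (fun u => proj1 (mu_ge0 u)) stat1 (fun u => proj1 (slack u));
  have min2 := multipliers_minimize _ _ _ psi_convex _ _ mu2 pc2 Fphat
    (fun u => proj2 (mu_ge0 u)) stat2 (fun u => proj2 (slack u)).
- exact: le_LU_anti le_phat (conj min1 min2).
- exact: le_CW_anti le_phat (conj min1 min2).
Qed.
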